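(* With notation as below, suppose $\Phi_1<\Phi_2$, i.e. $\Phi_1(t)\le\Phi_2(t)$ for all $t\in(0,1)$ with strict inequality for at least one $t\in(0,1)$. Then: (a) if $\alpha<0$, then $\mu_1(\alpha)<\mu_2(\alpha)$; (b) if $0<\alpha<\tfrac12$, then $\mu_1(\alpha)>\mu_2(\alpha)$; (c) $\mu_1'>\mu_2'$.
   Context: For $j=1,2$, let $\xi_j$ be a random variable with values in $\{0,1,2,\dots\}$ with $\mathbb E\xi_j=1$ and $0<\operatorname{Var}\xi_j<\infty$, with probability generating function $\Phi_j(t)=\mathbb E t^{\xi_j}$, and let $\mathcal T^{(j)}$ be a Galton–Watson tree with offspring distribution $\xi_j$. For real $\alpha<1/2$, $\mu_j(\alpha):=\mathbb E|\mathcal T^{(j)}|^\alpha$ and $\mu_j':=\mathbb E\log|\mathcal T^{(j)}|$, where $|\cdot|$ is the number of vertices. *)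

(* Defs.v *)
From HB Require Import structures.
From mathcomp Require Import all_boot all_order all_algebra.
From mathcomp Require Import all_classical all_reals all_analysis.
Set Implicit Arguments. Unset Strict Implicit. Unset Printing Implicit Defensive.
Import Order.TTheory GRing.Theory Num.Theory.
Local Open Scope classical_set_scope.
Local Open Scope ring_scope.

Inductive ptree : Type := PNode of seq ptree.

Fixpoint psize (t : ptree) : nat :=
  let: PNode l := t in (foldr (fun c acc => psize c + acc) 0 l).+1.

Fixpoint ptree_enc (t : ptree) : GenTree.tree unit :=
  let: PNode l := t in GenTree.Node 0 (map ptree_enc l).
Fixpoint ptree_dec (g : GenTree.tree unit) : option ptree :=
  match g with
  | GenTree.Leaf _ => None
  | GenTree.Node _ l => Some (PNode (pmap ptree_dec l))
  end.
Lemma ptree_encK : pcancel ptree_enc ptree_dec.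
Proof.
rewrite /pcancel; fix IH 1; case=> l /=; congr (Some (PNode _)).
elim: l => //= t l IHl; by rewrite IH /= IHl.
Qed.
HB.instance Definition _ := Countable.copy ptree (pcan_type ptree_encK).

Section GW.
Variable R : realType.

(* Galton-Watson law: P(T = t) = prod over vertices v of p(outdeg v). *)
Fixpoint gw_weight (p : nat -> R) (t : ptree) : R :=
  let: PNode l := t in p (size l) * foldr (fun c acc => gw_weight p c * acc) 1 l.

(* An offspring distribution xi on {0,1,2,...} given by its law p k = P(xi = k),
   with E xi = 1 and 0 < Var xi < oo  (Var xi = E (xi - 1)^2 since E xi = 1). *)
Definition critical_offspring (p : nat -> R) : Prop :=
  [/\ (forall k, 0 <= p k),
      (\sum_(0 <= k <oo) (p k)%:E = 1)%E,
      (\sum_(0 <= k <oo) (k%:R * p k)%:E = 1)%E,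
      (0 < \sum_(0 <= k <oo) (((k%:R - 1) ^+ 2) * p k)%:E)%E &
      (\sum_(0 <= k <oo) (((k%:R - 1) ^+ 2) * p k)%:E < +oo)%E].

Definition pgf (p : nat -> R) (t : R) : \bar R :=
  \sum_(0 <= k <oo) (p k * t ^+ k)%:E.

Definition gw_moment (p : nat -> R) (alpha : R) : \bar R :=
  \esum_(t in [set: ptree]) (gw_weight p t * (psize t)%:R `^ alpha)%:E.

Definition gw_logmoment (p : nat -> R) : \bar R :=
  \esum_(t in [set: ptree]) (gw_weight p t * ln (psize t)%:R)%:E.

Definition pgf_lt (p1 p2 : nat -> R) : Prop :=
  (forall t : R, 0 < t < 1 -> (pgf p1 t <= pgf p2 t)%E) /\
  (exists2 t : R, 0 < t < 1 & (pgf p1 t < pgf p2 t)%E).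

End GW.

(* Main.v *)
(* Write [Y z = E z ^ |T|]; it is the least solution of [y = z * phi y],
   whence [Y1 <= Y2] when [phi1 <= phi2]; since [phi] is 1-Lipschitz on [0, 1]
   the solution is unique for [z < 1] and depends continuously on [z], so the
   inequality is strict on an interval.  With [gumbel v = exp (- e ^ v)], Fubini
   and translation invariance give, for a constant [K] depending on [al] only,
     int_R e ^ (- al v) (gumbel v - gumbel v ^ n) dv = K * int_0^(ln n) e ^ (al w) dw,
   and the last integral is [(n ^ al - 1) / al], or [ln n] if [al = 0].  Taking
   expectations turns the three claims into the single comparison of
     int_R e ^ (- al v) (gumbel v - Y (gumbel v)) dv
   for the two laws.  The integral is finite for [al < 1/2] because
   [phi t >= t + c (1 - t) ^ 2] forces [1 - Y z = O(sqrt (1 - z))]. *)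
Require Import Defs.
From HB Require Import structures.
From mathcomp Require Import all_boot all_order all_algebra.
From mathcomp Require Import all_classical all_reals all_analysis.
From mathcomp Require Import measurable_realfun.
From mathcomp Require Import ring lra.
Set Implicit Arguments.
Unset Strict Implicit.
Unset Printing Implicit Defensive.
Import Order.TTheory GRing.Theory Num.Theory.
Import numFieldNormedType.Exports.
Local Open Scope classical_set_scope.
Local Open Scope ring_scope.

(** * Total mass of a Galton-Watson measure *)

Section Trees.
Context {R : realType}.
Implicit Types (p : nat -> R) (t : ptree).

(** The subtrees sit inside a list, so the generated induction principle gives no hypothesis on
    them. *)
Lemma ptree_nested_ind (P : ptree -> Prop) :
  (forall l, (forall t, t \in l -> P t) -> P (PNode l)) -> forall t, P t.
Proof.
move=> H; fix IH 1; case=> l; apply: H; elim: l => [|t l IHl] u.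
  (* [IH] must not close this case: the recursive call would be unguarded. *)
  by clear IH.
by rewrite inE => /predU1P[->|]; [exact: IH | exact: IHl].
Qed.

Lemma gw_weightE p l :
  gw_weight p (PNode l) = p (size l) * \prod_(c <- l) gw_weight p c.
Proof.
rewrite [LHS]/=; congr *%R.
by elim: l => [|t l IHl]; rewrite ?big_nil ?big_cons //= IHl.
Qed.

Lemma psizeE l : psize (PNode l) = (\sum_(c <- l) psize c).+1.
Proof.
by rewrite /=; congr S; elim: l => [|t l IHl]; rewrite ?big_nil ?big_cons //= IHl.
Qed.

Lemma psize_gt0 t : (0 < psize t)%N.
Proof. by case: t. Qed.

Lemma gw_weight_ge0 p t : (forall k, 0 <= p k) -> 0 <= gw_weight p t.
Proof.
move=> p0; elim/ptree_nested_ind: t => l IHl.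
by rewrite gw_weightE mulr_ge0// big_seq prodr_ge0.
Qed.

(** Each vertex contributes one factor [z], so the size generating function at [z] is the total mass
    of the tree weights built on [z * p]. *)
Lemma gw_weightZ p z t :
  gw_weight (fun k => z * p k) t = gw_weight p t * z ^+ psize t.
Proof.
elim/ptree_nested_ind: t => l IHl; rewrite !gw_weightE psizeE.
rewrite big_seq (eq_bigr _ IHl) -big_seq big_split /= -expr_sum exprS.
by ring.
Qed.

Lemma esumZl (T : choiceType) (A : set T) (c : R) (f : T -> \bar R) :
  0 <= c -> (forall x, 0 <= f x)%E ->
  (\esum_(x in A) (c%:E * f x) = c%:E * \esum_(x in A) f x)%E.
Proof.
move=> c0 f0; rewrite /esum -ereal_supZl//; last first.
  by apply/set0P; exists 0%E => /=; exists set0; [split|rewrite fsbig_set0].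
congr ereal_sup; rewrite image_comp; apply: eq_imagel => B [_ BA].
by rewrite /= ge0_mule_fsumr.
Qed.

Definition forests (A : set ptree) (k : nat) : set (seq ptree) :=
  [set l | size l = k /\ forall t, t \in l -> A t].

(** The [k] trees are independent: induction on [k] splits off the first one and sums over pairs. *)
Lemma esum_forests p (A : set ptree) (s : R) k : (forall k, 0 <= p k) ->
  (\esum_(t in A) (gw_weight p t)%:E = s%:E)%E ->
  (\esum_(l in forests A k) (\prod_(c <- l) gw_weight p c)%:E = (s ^+ k)%:E)%E.
Proof.
move=> p0 As; have w0 t : 0 <= gw_weight p t by exact: gw_weight_ge0.
have P0 (l : seq ptree) : 0 <= \prod_(c <- l) gw_weight p c by exact: prodr_ge0.
elim: k => [|k IHk].
  rewrite (_ : forests A 0 = [set [::]]); first by rewrite esum_set1 big_nil.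
  by apply/seteqP; split => [l []/size0nil|l ->].
rewrite (reindex_esum (A `*` forests A k) _ (fun x => x.1 :: x.2)); last first.
  split.
  - move=> [t l] [/= At [<- Al]]; split => // u.
    by rewrite inE => /predU1P[->|/Al].
  - by move=> [t l] [t' l'] _ _ /= [-> ->].
  - move=> [|t l] [//= [<-]] Al; exists (t, l) => //; split => /=.
      by apply: Al; rewrite mem_head.
    by split => // u ul; apply: Al; rewrite inE ul orbT.
rewrite -(esum_esum (J := fun=> forests A k)
  (a := fun t l => (\prod_(c <- t :: l) gw_weight p c)%:E)); last first.
  by move=> t l _ _; rewrite lee_fin.
under eq_esum => t _.
  under eq_esum => l _ do rewrite big_cons EFinM.
  rewrite esumZl// IHk muleC; over.
rewrite esumZl ?As -?EFinM ?exprSr//.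
by rewrite exprn_ge0// -lee_fin -As; apply: esum_ge0 => t _; rewrite lee_fin.
Qed.

(** Classifies trees by root degree. With all trees it gives the fixed-point equation, with the
    trees of size at most [n] the induction step for minimality. *)
Lemma esum_node_forests p (A : set ptree) (s : R) : (forall k, 0 <= p k) ->
  (\esum_(t in A) (gw_weight p t)%:E = s%:E)%E ->
  (\esum_(t in PNode @` [set l : seq ptree | forall t, t \in l -> A t]) (gw_weight p t)%:E
   = \sum_(0 <= k <oo) (p k * s ^+ k)%:E)%E.
Proof.
move=> p0 As; have w0 t : 0 <= gw_weight p t by exact: gw_weight_ge0.
have s0 : 0 <= s.
  by rewrite -lee_fin -As; apply: esum_ge0 => t _; rewrite lee_fin.
rewrite esum_image; last by move=> l l' _ _ [].
rewrite (_ : [set l | _] = \bigcup_(k in setT) forests A k); last first.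
  by apply/seteqP; split => [l Al|l [k _ []]//]; exists (size l).
rewrite esum_bigcupT; [|by move=> i j _ _ [l [[<- _] [<- _]]]|]; last first.
  by move=> l; rewrite lee_fin.
rewrite nneseries_esumT; last first.
  by move=> k; rewrite lee_fin mulr_ge0// exprn_ge0.
apply: eq_esum => k _.
under eq_esum => l kl.
  rewrite gw_weightE kl.1 EFinM; over.
rewrite esumZl//; last by move=> l; rewrite lee_fin prodr_ge0.
by rewrite (esum_forests _ _ As)// EFinM.
Qed.

Lemma gw_total_fix p (s : R) : (forall k, 0 <= p k) ->
  (\esum_(t in [set: ptree]) (gw_weight p t)%:E = s%:E)%E ->
  (\sum_(0 <= k <oo) (p k * s ^+ k)%:E = s%:E)%E.
Proof.
move=> p0 As; rewrite -(esum_node_forests _ As)// -As; congr esum.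
by apply/seteqP; split => // -[l] _; exists l.
Qed.

(* The total mass is the increasing limit of the masses of the sets of trees
   with at most [n] vertices, each of which lies below any supersolution. *)
Lemma gw_total_le p (s : R) : (forall k, 0 <= p k) -> 0 <= s ->
  (\sum_(0 <= k <oo) (p k * s ^+ k)%:E <= s%:E)%E ->
  (\esum_(t in [set: ptree]) (gw_weight p t)%:E <= s%:E)%E.
Proof.
move=> p0 s0 ps; have w0 t : 0 <= gw_weight p t by exact: gw_weight_ge0.
have small n : (\esum_(t in [set t | (psize t <= n)%N]) (gw_weight p t)%:E <= s%:E)%E.
  elim: n => [|n IHn].
    rewrite (_ : [set t | _] = set0) ?esum_set0//.
    by apply/seteqP; split => // t /=; rewrite leqNgt psize_gt0.
  set A := [set t | (psize t <= n)%N] in IHn *.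
  have A0 : (0 <= \esum_(t in A) (gw_weight p t)%:E)%E.
    by apply: esum_ge0 => t _; rewrite lee_fin.
  have [a Aa] : exists a, \esum_(t in A) (gw_weight p t)%:E = a%:E.
    exists (fine (\esum_(t in A) (gw_weight p t)%:E)); rewrite fineK//.
    by rewrite ge0_fin_numE// (le_lt_trans IHn) ?ltry.
  rewrite Aa !lee_fin in A0 IHn.
  have := esum_node_forests p0 Aa.
  set B := _ @` _ => EB; apply: (@le_trans _ _ (\esum_(t in B) (gw_weight p t)%:E)%E).
    (* A tree with at most [n + 1] vertices has root subtrees with at most [n], so it lies in
       [B]. *)
    rewrite [leLHS]esum_mkcond [leRHS]esum_mkcond le_esum// => -[l] _.
    case: ifPn => [/set_mem Hl|_]; last by case: ifPn; rewrite lee_fin.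
    rewrite mem_set//; exists l => //= t tl; move: Hl; rewrite /mkset psizeE ltnS.
    apply: leq_trans.
    by rewrite (big_rem _ tl)/= leq_addr.
  rewrite EB; apply: le_trans ps; apply: lee_nneseries => [k _ _|k _].
    by rewrite lee_fin mulr_ge0// exprn_ge0.
  by rewrite lee_fin ler_wpM2l// lerXn2r.
(* The full sum is a supremum over finite sets of trees, and a finite set has bounded sizes. *)
apply: ge_ereal_sup => _ [X [finX _] <-].
have [n Xn] : exists n, X `<=` [set t | (psize t <= n)%N].
  have /finite_seqP[r ->] := finX.
  by exists (\max_(t <- r) psize t)%N => t rt; exact: leq_bigmax_seq.
apply: le_trans (small n); apply: ereal_sup_ubound; exists X => //.
Qed.

End Trees.

(** * Offspring and total size generating functions *)

Lemma exprn_tangent_le {R : realType} (t : R) k : 0 <= t <= 1 ->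
  1 <= t ^+ k + k%:R * (1 - t).
Proof.
move=> /andP[t0 t1]; elim: k => [|k IHk]; first by rewrite expr0; lra.
have tk1 : t ^+ k <= 1 by rewrite exprn_ile1.
rewrite -natr1 exprS; nra.
Qed.

(** Equality holds at [k = 2]; raising [k] by one adds [(1 - t) * (1 - t ^ k) >= 0] on the right. *)
Lemma exprn_tangent_quad_le {R : realType} (t : R) k : 0 <= t <= 1 -> (2 <= k)%N ->
  1 + (1 - t) ^+ 2 <= t ^+ k + k%:R * (1 - t).
Proof.
move=> /andP[t0 t1]; case: k => [|[|k]] // _.
elim: k => [|k IHk]; first by rewrite expr2; nra.
have tk1 : t ^+ k.+2 <= 1 by rewrite exprn_ile1.
rewrite -[k.+3%:R]natr1 (exprS _ k.+2); nra.
Qed.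

Lemma exprn_lip_le {R : realType} (a b : R) k : 0 <= a -> a <= b -> b <= 1 ->
  b ^+ k <= a ^+ k + (b - a) * k%:R.
Proof.
move=> a0 ab b1; elim: k => [|k IHk]; first by rewrite !expr0; lra.
have bk1 : b ^+ k <= 1 by rewrite exprn_ile1// (le_trans a0).
have bk0 : 0 <= b ^+ k by rewrite exprn_ge0// (le_trans a0).
have h1 := ler_wpM2l a0 IHk.
have h2 : 0 <= (1 - a) * (b - a) * k%:R by rewrite !mulr_ge0 ?ler0n; lra.
have h3 : 0 <= (b - a) * (1 - b ^+ k) by rewrite mulr_ge0; lra.
rewrite -natr1 !exprS; lra.
Qed.

Section Pgf.
Context {R : realType}.
Variable p : nat -> R.
Hypothesis crit : critical_offspring p.

Definition phi (t : R) : R := fine (pgf p t).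

Let p0 k : 0 <= p k. Proof. by case: crit. Qed.
Let sum_p : (\sum_(0 <= k <oo) (p k)%:E = 1)%E. Proof. by case: crit. Qed.
Let mean_p : (\sum_(0 <= k <oo) (k%:R * p k)%:E = 1)%E. Proof. by case: crit. Qed.

Let sumD (f g : nat -> R) : (forall k, 0 <= f k) -> (forall k, 0 <= g k) ->
  (\sum_(0 <= k <oo) (f k + g k)%:E =
   \sum_(0 <= k <oo) (f k)%:E + \sum_(0 <= k <oo) (g k)%:E)%E.
Proof.
move=> f0 g0; under eq_eseriesr do rewrite EFinD.
by rewrite nneseriesD// => k _ _; rewrite lee_fin.
Qed.

Let sumZ (c : R) (f : nat -> R) : (forall k, 0 <= f k) ->
  (\sum_(0 <= k <oo) (c * f k)%:E = c%:E * \sum_(0 <= k <oo) (f k)%:E)%E.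
Proof.
move=> f0; under eq_eseriesr do rewrite EFinM.
by rewrite nneseriesZl// => k _; rewrite lee_fin.
Qed.

Let le_sum (f g : nat -> R) : (forall k, 0 <= f k) -> (forall k, f k <= g k) ->
  (\sum_(0 <= k <oo) (f k)%:E <= \sum_(0 <= k <oo) (g k)%:E)%E.
Proof.
by move=> f0 fg; apply: lee_nneseries => [k _ _|k _]; rewrite lee_fin.
Qed.

Let pt0 (t : R) k : 0 <= t -> 0 <= p k * t ^+ k.
Proof. by move=> t0; rewrite mulr_ge0// exprn_ge0. Qed.

Lemma pgfE (t : R) : 0 <= t <= 1 -> pgf p t = (phi t)%:E.
Proof.
move=> /andP[t0 t1]; rewrite /phi fineK// ge0_fin_numE; last first.
  by apply: nneseries_ge0 => k _ _; rewrite lee_fin pt0.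
apply: (@le_lt_trans _ _ 1%E); last exact: ltry.
rewrite -sum_p; apply: le_sum => k; first exact: pt0.
by rewrite -[leRHS]mulr1 ler_wpM2l// exprn_ile1.
Qed.

Lemma le_phi (a b : R) : 0 <= a -> a <= b -> b <= 1 -> phi a <= phi b.
Proof.
move=> a0 ab b1; rewrite -lee_fin -!pgfE; [|lra..].
by apply: le_sum => k; [exact: pt0 | rewrite ler_wpM2l// lerXn2r// nnegrE; lra].
Qed.

(** The slope of [t ^ k] on [0, 1] is at most [k], and averaging gives the mean, which is 1. *)
Lemma phi_lip (a b : R) : 0 <= a -> a <= b -> b <= 1 -> phi b - phi a <= b - a.
Proof.
move=> a0 ab b1; rewrite lerBlDl -lee_fin EFinD -!pgfE; [|lra..].
rewrite -[(b - a)%:E]mule1 -mean_p -sumZ; last by move=> k; rewrite mulr_ge0.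
rewrite -sumD; [|by move=> k; rewrite ?pt0..|]; last first.
  by move=> k; rewrite !mulr_ge0// subr_ge0.
apply: le_sum => k; first by rewrite pt0// (le_trans a0).
have := ler_wpM2l (p0 k) (exprn_lip_le k a0 ab b1); lra.
Qed.

Lemma phi1 : phi 1 = 1.
Proof.
apply: EFin_inj; rewrite -pgfE ?lexx ?ler01// -[RHS]sum_p.
by apply: eq_eseriesr => k _; rewrite expr1n mulr1.
Qed.

Lemma phi_ge0 (t : R) : 0 <= t <= 1 -> 0 <= phi t.
Proof.
move=> t01; rewrite -lee_fin -pgfE//; apply: nneseries_ge0 => k _ _.
by rewrite lee_fin pt0//; case/andP: t01.
Qed.

Lemma phi_le1 (t : R) : 0 <= t <= 1 -> phi t <= 1.
Proof. by move=> /andP[t0 t1]; rewrite -phi1 le_phi. Qed.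

(* As [phi] is 1-Lipschitz, [s |-> z * phi s] is a contraction for [z < 1]. *)
Lemma phi_root_lip (z z' s y : R) : z' <= z -> 0 <= z -> 0 <= s -> s <= y -> y <= 1 ->
  s = z' * phi s -> y = z * phi y -> (1 - z) * (y - s) <= z - z'.
Proof.
move=> z'z z0 s0 sy y1 sE yE.
have h := ler_wpM2l z0 (phi_lip s0 sy y1).
have phis1 : phi s <= 1 by apply: phi_le1; rewrite s0 (le_trans sy).
have h' : 0 <= (z - z') * (1 - phi s) by rewrite mulr_ge0; lra.
lra.
Qed.

(** On {0, 1} one has [k + (k - 1) ^ 2 = 1], so for a law carried by {0, 1} mean plus variance is 1,
    and mean 1 would make the variance vanish. *)
Lemma offspring_ge2 : exists2 k, (2 <= k)%N & 0 < p k.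
Proof.
apply: contrapT => no2.
have pk k : (2 <= k)%N -> p k = 0.
  move=> k2; apply/eqP; rewrite eq_le p0 andbT leNgt; apply/negP => pk.
  by apply: no2; exists k.
case: crit => _ _ _ + _; set V := (\sum_(0 <= k <oo) _)%E.
suff V0 : (1 + V = 1)%E by rewrite -(@lteDl _ 1%E)// V0 ltxx.
rewrite -[in LHS]mean_p -[RHS]sum_p -sumD; first last.
- by move=> k; rewrite mulr_ge0// sqr_ge0.
- by move=> k; rewrite mulr_ge0.
apply: eq_eseriesr => -[|[|k]] _; last by rewrite pk//; congr EFin; ring.
- by congr EFin; ring.
- by congr EFin; ring.
Qed.

(** Averages the tangent inequality for [t ^ k] at 1; a single value [k0 >= 2] of positive
    probability supplies the quadratic gain, so [c = p k0]. *)
Lemma phi_quad : exists2 c, 0 < c &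
  forall t, 0 <= t <= 1 -> t + c * (1 - t) ^+ 2 <= phi t.
Proof.
have [k0 k02 pk0] := offspring_ge2; exists (p k0) => // t t01.
have [t0 t1] := andP t01.
pose d k : R := if k == k0 then p k0 * (1 - t) ^+ 2 else 0.
have d0 k : 0 <= d k by rewrite /d; case: ifP => // _; rewrite mulr_ge0// sqr_ge0.
suff : ((1 + p k0 * (1 - t) ^+ 2)%:E <= (phi t + (1 - t))%:E)%E.
  by rewrite lee_fin; lra.
apply: (@le_trans _ _ (\sum_(0 <= k <oo) (p k + d k)%:E)%E).
  rewrite sumD// sum_p EFinD leeD2l// (nneseriesD1 (n := k0))//; last first.
    by move=> k _; rewrite lee_fin.
  by rewrite {1}/d eqxx leeDl// nneseries_ge0// => k _ _; rewrite lee_fin.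
rewrite EFinD -pgfE// -[(1 - t)%:E]mule1 -mean_p -sumZ; last first.
  by move=> k; rewrite mulr_ge0.
rewrite -sumD; [|by move=> k; rewrite ?pt0..|]; last first.
  by move=> k; rewrite !mulr_ge0// subr_ge0.
apply: le_sum => k; first by rewrite addr_ge0.
rewrite /d; case: eqP => [->|_].
  have := ler_wpM2l (p0 k0) (exprn_tangent_quad_le t01 k02); lra.
have := ler_wpM2l (p0 k) (exprn_tangent_le k t01); lra.
Qed.

End Pgf.

Section TreeGf.
Context {R : realType}.

(** The [Y] of the outline; on [0, 1] the sum is at most 1, so [fine] loses nothing there. *)
Definition tree_gf (p : nat -> R) (z : R) : R :=
  fine (\esum_(t in [set: ptree]) (gw_weight p t * z ^+ psize t)%:E).

Variable p : nat -> R.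
Hypothesis crit : critical_offspring p.

Let p0 k : 0 <= p k. Proof. by case: crit. Qed.

Let zp (z s : R) : 0 <= z -> 0 <= s <= 1 ->
  (\sum_(0 <= k <oo) (z * p k * s ^+ k)%:E = (z * phi p s)%:E)%E.
Proof.
move=> z0 s01; rewrite EFinM -pgfE//.
under eq_eseriesr do rewrite -mulrA EFinM.
rewrite nneseriesZl// => k _; rewrite lee_fin mulr_ge0// exprn_ge0//.
by case/andP: s01.
Qed.

Let esumE (z : R) : (\esum_(t in [set: ptree]) (gw_weight p t * z ^+ psize t)%:E
  = \esum_(t in [set: ptree]) (gw_weight (fun k => z * p k) t)%:E)%E.
Proof. by apply: eq_esum => t _; rewrite gw_weightZ. Qed.

Let super (z s : R) : 0 <= z -> 0 <= s <= 1 -> z * phi p s <= s ->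
  (\esum_(t in [set: ptree]) (gw_weight p t * z ^+ psize t)%:E <= s%:E)%E.
Proof.
move=> z0 s01 zs; have /andP[s0 _] := s01; rewrite esumE.
by apply: gw_total_le => //; [move=> k; exact: mulr_ge0 | rewrite zp].
Qed.

Lemma tree_gfE (z : R) : 0 <= z <= 1 ->
  (\esum_(t in [set: ptree]) (gw_weight p t * z ^+ psize t)%:E = (tree_gf p z)%:E)%E.
Proof.
move=> /andP[z0 z1]; rewrite /tree_gf fineK// ge0_fin_numE; last first.
  apply: esum_ge0 => t _; rewrite lee_fin mulr_ge0 ?exprn_ge0//.
  exact: gw_weight_ge0.
apply: le_lt_trans (ltry 1); apply: super => //; first lra.
by rewrite phi1// mulr1.
Qed.

Lemma tree_gf_le (z s : R) : 0 <= z <= 1 -> 0 <= s <= 1 -> z * phi p s <= s ->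
  tree_gf p z <= s.
Proof.
move=> z01 s01 zs; rewrite -lee_fin -tree_gfE//; apply: super => //.
by case/andP: z01.
Qed.

Lemma tree_gf_ge0 (z : R) : 0 <= z <= 1 -> 0 <= tree_gf p z.
Proof.
move=> z01; rewrite -lee_fin -tree_gfE//; apply: esum_ge0 => t _.
rewrite lee_fin mulr_ge0 ?exprn_ge0//; first exact: gw_weight_ge0.
by case/andP: z01.
Qed.

Lemma tree_gf_le1 (z : R) : 0 <= z <= 1 -> tree_gf p z <= 1.
Proof. by move=> z01; apply: tree_gf_le => //; rewrite ?phi1//; lra. Qed.

Lemma tree_gf_fix (z : R) : 0 <= z <= 1 -> tree_gf p z = z * phi p (tree_gf p z).
Proof.
move=> z01; have /andP[z0 _] := z01.
have y01 : 0 <= tree_gf p z <= 1 by rewrite tree_gf_ge0// tree_gf_le1.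
apply: EFin_inj; rewrite -zp//; apply/esym/gw_total_fix.
  by move=> k; exact: mulr_ge0.
by rewrite -esumE tree_gfE.
Qed.

Lemma tree_gf_lez (z : R) : 0 <= z <= 1 -> tree_gf p z <= z.
Proof.
move=> z01; rewrite tree_gf_fix// -[leRHS]mulr1 ler_wpM2l//; first lra.
by apply: phi_le1 => //; rewrite tree_gf_ge0 ?tree_gf_le1.
Qed.

Lemma tree_gf_homo (z z' : R) : 0 <= z -> z <= z' -> z' <= 1 ->
  tree_gf p z <= tree_gf p z'.
Proof.
move=> z0 zz' z'1; have z'01 : 0 <= z' <= 1 by lra.
have y0 := tree_gf_ge0 z'01; have y1 := tree_gf_le1 z'01.
apply: tree_gf_le; [lra|lra|].
rewrite [leRHS]tree_gf_fix// ler_wpM2r//.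
by apply: phi_ge0 => //; rewrite y0.
Qed.

(** With [y] the value at [z], multiplying [phi_quad] by [z] and using [y = z * phi y] gives
    [z * c * (1 - y) ^ 2 <= y * (1 - z)]. This square-root behaviour at [z = 1] is the source of the
    threshold 1/2. *)
Lemma tree_gf_quad : exists2 c, 0 < c & forall z, 0 <= z <= 1 ->
  z * c * (1 - tree_gf p z) ^+ 2 <= 1 - z.
Proof.
have [c c0 quad] := phi_quad crit; exists c => // z z01.
have y0 := tree_gf_ge0 z01; have y1 := tree_gf_le1 z01.
have := quad _ (introT andP (conj y0 y1)) => {}quad.
have /andP[z0 z1] := z01.
have := ler_wpM2l z0 quad; rewrite -tree_gf_fix//.
have := sqr_ge0 (1 - tree_gf p z); nra.
Qed.

(** The quadratic bound at [z = 1] reads [c * (1 - y) ^ 2 <= 0]: a critical tree is almost surely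
    finite. *)
Lemma tree_gf1 : tree_gf p 1 = 1.
Proof.
have z01 : 0 <= (1 : R) <= 1 by rewrite ler01 lexx.
have [c c0 quad] := tree_gf_quad.
have := quad _ z01; rewrite mul1r subrr.
have y0 := tree_gf_ge0 z01; have y1 := tree_gf_le1 z01 => h.
apply/eqP; rewrite eq_sym -subr_eq0 -sqrf_eq0 eq_le sqr_ge0 andbT.
by rewrite -(ler_pM2l c0) mulr0.
Qed.

End TreeGf.

(** * Strict comparison of the size generating functions *)

Section Compare.
Context {R : realType} (p1 p2 : nat -> R).
Hypotheses (c1 : critical_offspring p1) (c2 : critical_offspring p2).
Hypothesis lt12 : pgf_lt p1 p2.

(** [tree_gf p2 z] is a supersolution for [p1], and [tree_gf p1 z] lies below all of these. *)
Lemma le_tree_gf (z : R) : 0 < z < 1 -> tree_gf p1 z <= tree_gf p2 z.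
Proof.
move=> z01; have z01' : 0 <= z <= 1 by lra.
have y0 := tree_gf_ge0 c2 z01'; have y1 := tree_gf_lez c2 z01'.
have y01 : 0 <= tree_gf p2 z <= 1 by lra.
apply: tree_gf_le => //; rewrite [leRHS](tree_gf_fix c2)//.
rewrite ler_wpM2l//; first lra.
(* The generating functions are compared only inside (0, 1); the value 0 is excluded because
   [phi p2 0 >= c > 0]. *)
have [yp|y0'] := ltP 0 (tree_gf p2 z).
  by rewrite -lee_fin -!pgfE//; apply lt12.1; lra.
have [c c0 quad] := phi_quad c2.
have := quad _ y01; have := tree_gf_fix c2 z01'.
have -> : tree_gf p2 z = 0 by lra.
nra.
Qed.

(** At the [z0] where [tree_gf p2] takes a value [t0] separating the two generating functions,
    [tree_gf p1] is strictly smaller; the Lipschitz bound carries the gap to the right of [z0]. *)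
Lemma lt_tree_gf : exists e z0 z1 : R, [/\ 0 < e, 0 < z0, z0 < z1, z1 < 1 &
  forall z, z0 <= z <= z1 -> tree_gf p1 z + e <= tree_gf p2 z].
Proof.
have [t0 t01 ltt] := lt12.2; have t01' : 0 <= t0 <= 1 by lra.
rewrite !pgfE// lte_fin in ltt.
have [c c0 quad] := phi_quad c2; have qt := quad _ t01'.
have pt : t0 < phi p2 t0.
  apply: lt_le_trans qt; rewrite ltrDl mulr_gt0// exprn_gt0//; lra.
(* Solves [t0 = z0 * phi p2 t0]; [z0 < 1] because [phi p2] lies above the diagonal at [t0]. *)
pose z0 := t0 / phi p2 t0.
have pp : 0 < phi p2 t0 by lra.
have z00 : 0 < z0 by rewrite divr_gt0//; lra.
have z01 : z0 < 1 by rewrite ltr_pdivrMr// mul1r.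
have z0E : t0 = z0 * phi p2 t0 by rewrite /z0 divfK// gt_eqF.
have z0i : 0 <= z0 <= 1 by lra.
have y2E : tree_gf p2 z0 = t0.
  have le : tree_gf p2 z0 <= t0 by apply: tree_gf_le => //; rewrite -z0E.
  (* Two ordered roots for the same [z0 < 1] coincide. *)
  have := phi_root_lip c2 (lexx z0) (ltW z00) (tree_gf_ge0 c2 z0i) le _
    (tree_gf_fix c2 z0i) z0E.
  rewrite subrr => /(_ ltac:(lra)); nra.
have y1lt : tree_gf p1 z0 < t0.
  rewrite lt_neqAle -[X in _ <= X]y2E le_tree_gf ?z00// andbT.
  apply/eqP => y1E; have := tree_gf_fix c1 z0i; rewrite y1E [LHS]z0E => h.
  have := ltr_pM2l z00 (phi p1 t0) (phi p2 t0); rewrite ltt h ltxx//.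
(* The gap at [z0] is [3 * e]; up to [z1] the first function grows by at most [2 * e], and the
   second does not decrease. *)
pose e := (t0 - tree_gf p1 z0) / 3; pose z1 := z0 + e * (1 - z0).
have y10 := tree_gf_ge0 c1 z0i.
have e0 : 0 < e by rewrite /e; lra.
have e1 : e < 1/3 by rewrite /e; lra.
exists (e / 2), z0, z1; have z01' : z0 < z1 by rewrite /z1 ltrDl mulr_gt0//; lra.
have z11 : z1 < 1 by rewrite /z1; nra.
split => //; first lra.
move=> z /andP[z0z zz1].
have zi : 0 <= z <= 1 by lra.
have h2 : t0 <= tree_gf p2 z by rewrite -y2E tree_gf_homo//; lra.
have h1 := tree_gf_homo c1 (ltW z00) z0z (ltW (le_lt_trans zz1 z11)).
have := phi_root_lip c1 z0z (ltW (lt_le_trans z00 z0z)) y10 h1 (tree_gf_le1 c1 zi)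
  (tree_gf_fix c1 z0i) (tree_gf_fix c1 zi).
have eE : t0 - tree_gf p1 z0 = 3 * e by rewrite /e; lra.
have : z - z0 <= e * (1 - z0) by rewrite /z1 in zz1; lra.
set d := tree_gf p1 z - _.
have d0 : 0 <= d by rewrite /d; lra.
move=> hz hd.
suff : d <= 2 * e by rewrite /d; lra.
have : (1 - z0) * d * (2/3) <= (1 - z0) * e.
  have : (1 - z) >= (1 - z0) * (2/3) by nra.
  nra.
rewrite -mulrA ler_pM2l; lra.
Qed.

End Compare.

(** * The integral kernel *)

(** Turns a sum over trees into a series, to be exchanged with an integral; indices coding no
    element contribute 0. *)
Lemma esum_pickle {R : realType} (T : countType) (f : T -> \bar R) :
  (forall x, 0 <= f x)%E ->
  (\esum_(x in [set: T]) f x = \sum_(0 <= n <oo) oapp f 0 (pickle_inv n))%E.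
Proof.
move=> f0; have g0 n : (0 <= oapp f 0 (@pickle_inv T n))%E by case: pickle_inv.
rewrite nneseries_esumT//.
transitivity (\esum_(n in range (@pickle T)) oapp f 0%E (@pickle_inv T n)).
  rewrite esum_image; last by move=> x y _ _; exact: (pcan_inj pickleK).
  by apply: eq_esum => x _; rewrite pickleK_inv.
rewrite esum_mkcond; apply: eq_esum => n _.
case: ifPn => //; case E : pickle_inv => [x|//]; move=> /negP[].
rewrite inE; exists x => //.
by have := @pickle_invK T n; rewrite E.
Qed.

Section Kernel.
Context {R : realType}.
Notation mu := (@lebesgue_measure R).

Lemma measurable_expRM (c : R) : measurable_fun setT (fun v : R => expR (c * v)).
Proof.
apply: measurableT_comp; first exact: measurable_expR.
exact: mulrl_measurable.
Qed.

Lemma integralT_shift (f : R -> R) (w : R) : continuous f -> (forall x, 0 <= f x) ->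
  (\int[mu]_x (f (x + w))%:E = \int[mu]_x (f x)%:E)%E.
Proof.
move=> cf f0.
have dF (x : R) : is_derive x 1 (fun y : R => y + w) 1.
  by apply: is_derive_eq; rewrite addr0.
have F'E : derive1 (fun y : R => y + w) = cst 1.
  by apply/funext => x; rewrite derive1E; exact: derive_val.
rewrite [RHS](@increasing_ge0_integration_by_substitutionT _ (fun y => y + w))//.
- by apply: eq_integral => x _; rewrite F'E /= mulr1.
- by move=> x y xy; rewrite ltrD2r.
- rewrite F'E; exact: cst_continuous.
- rewrite F'E; exact: is_cvg_cst.
- rewrite F'E; exact: is_cvg_cst.
- apply/cvgrNyPle => A; near=> x.
  by rewrite -lerBrDr; near: x; apply: nbhs_ninfty_le; exact: num_real.
- apply/cvgryPge => A; near=> x.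
  by rewrite -lerBlDr; near: x; apply: nbhs_pinfty_ge; exact: num_real.
Unshelve. all: by end_near. Qed.

(** A reflected Gumbel distribution function, decreasing from 1 to 0; its [n]-th power is its
    translate by [ln n]. *)
Definition gumbel (v : R) : R := expR (- expR v).

Global Instance is_derive_gumbel (v : R) :
  is_derive v 1 gumbel (- (expR v * gumbel v)).
Proof.
have h : is_derive v 1 (expR \o (fun v => - expR v)) (expR (- expR v) * - expR v).
  exact: is_derive1_comp.
by apply: is_derive_eq h _; rewrite mulrN mulrC.
Qed.

Lemma continuous_gumbel : continuous gumbel.
Proof.
move=> v; apply: differentiable_continuous; apply/derivable1_diffP.
exact: ex_derive.
Qed.

(** Minus the derivative of [gumbel], hence a probability density. *)
Let k (v : R) : R := expR v * gumbel v.

Let k_ge0 v : 0 <= k v.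
Proof. by rewrite mulr_ge0 ?expR_ge0. Qed.

Let ck : continuous k.
Proof.
by move=> v; apply: cvgM; [exact: continuous_expR|exact: continuous_gumbel].
Qed.

Lemma integral_gumbelB (v a : R) : 0 <= a ->
  (\int[mu]_(w in `[0%R, a]) (k (v + w))%:E = (gumbel v - gumbel (v + a))%:E)%E.
Proof.
rewrite le_eqVlt => /predU1P[<-|a0].
  by rewrite set_itv1 integral_set1 addr0 subrr.
pose F w := - gumbel (v + w).
have dF (w : R) : is_derive w 1 F (k (v + w)).
  have hv : is_derive w 1 (fun w => v + w) 1.
    by apply: is_derive_eq; rewrite add0r mulr1.
  have h := is_deriveN (is_derive1_comp (is_derive_gumbel (v + w)) hv).
  by apply: is_derive_eq h _; rewrite mulr1 opprK.
have cF : continuous F.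
  by move=> w; apply: differentiable_continuous; apply/derivable1_diffP; exact: ex_derive.
rewrite (@continuous_FTC2 _ _ F)//.
- by rewrite /F addr0 -EFinB opprK addrC.
- apply: continuous_subspaceT => w; apply: continuous_comp; last exact: ck.
  by apply: cvgD; [exact: cvg_cst|exact: cvg_id].
- split.
  + by move=> w _; exact: ex_derive.
  + by apply: cvg_at_right_filter; exact: cF.
  + by apply: cvg_at_left_filter; exact: cF.
- by move=> w _; rewrite derive1E; exact: derive_val.
Qed.

(** The Box-Cox transform: at [a = ln n] it is [(n ^ al - 1) / al], with its limit [ln n] at
    [al = 0], so powers and the logarithm are handled together. *)
Definition box (al a : R) : R := if al == 0 then a else (expR (al * a) - 1) / al.

Lemma integral_expR_box (al a : R) : 0 <= a ->
  (\int[mu]_(w in `[0%R, a]) (expR (al * w))%:E = (box al a)%:E)%E.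
Proof.
rewrite le_eqVlt => /predU1P[<-|a0].
  by rewrite set_itv1 integral_set1 /box mulr0 expR0 subrr mul0r if_same.
have [->|al0] := eqVneq al 0.
  rewrite (eq_integral (cst 1%:E)); last by move=> w _; rewrite mul0r expR0.
  rewrite integral_cst//= mul1e lebesgue_measure_itv/= lte_fin a0 oppr0 adde0.
  by rewrite /box eqxx.
pose F w := expR (al * w) / al.
have dF (w : R) : is_derive w 1 F (expR (al * w)).
  have hv : is_derive w 1 (fun w => al * w) al.
    by apply: is_derive_eq; exact: mulr1.
  have h := is_deriveZ al^-1 (is_derive1_comp (is_derive_expR (al * w)) hv).
  rewrite (_ : F = al^-1 *: (expR \o (fun w => al * w))); last first.
    by apply/funext => x; rewrite /F mulrC.
  by apply: is_derive_eq h _; rewrite /GRing.scale/= mulrCA mulVf ?mulr1.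
have cF : continuous F.
  by move=> w; apply: differentiable_continuous; apply/derivable1_diffP; exact: ex_derive.
rewrite (@continuous_FTC2 _ _ F)//.
- by rewrite /F /box (negbTE al0) mulr0 expR0 -EFinB mulrBl.
- apply: continuous_subspaceT => w; apply: continuous_comp; last exact: continuous_expR.
  by apply: cvgM; [exact: cvg_cst|exact: cvg_id].
- split.
  + by move=> w _; exact: ex_derive.
  + by apply: cvg_at_right_filter; exact: cF.
  + by apply: cvg_at_left_filter; exact: cF.
- by move=> w _; rewrite derive1E; exact: derive_val.
Qed.

(** For [al < 1] this is [Gamma (1 - al)], by the substitution [u = expR v]. *)
Definition kernel_mass (al : R) : \bar R :=
  (\int[mu]_v (expR (- al * v) * k v)%:E)%E.

Lemma kernel_mass_ge0 al : (0 <= kernel_mass al)%E.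
Proof. by apply: integral_ge0 => v _; rewrite lee_fin mulr_ge0 ?expR_ge0. Qed.

Lemma integral_kernel (al a : R) : 0 <= a ->
  (\int[mu]_v (expR (- al * v) * (gumbel v - gumbel (v + a)))%:E =
   kernel_mass al * (box al a)%:E)%E.
Proof.
move=> a0.
have mk : measurable_fun setT k by exact: continuous_measurable_fun.
pose D := `[0%R, a]%classic : set R.
have mI : measurable_fun setT (\1_D : R -> R) by apply: measurable_indic; exact: measurable_itv.
pose f (x : R * R) := (expR (- al * x.1) * k (x.1 + x.2) * \1_D x.2)%:E.
have mf : measurable_fun setT f.
  apply/measurable_EFinP; apply: measurable_funM; first apply: measurable_funM.
  - exact: (measurableT_comp (measurable_expRM _)).
  - by apply: (measurableT_comp mk); exact: measurable_funD.
  - exact: (measurableT_comp mI).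
have f0 x : (0 <= f x)%E.
  by rewrite lee_fin !mulr_ge0 ?expR_ge0// indicE.
have onD (h : R -> R) :
    (\int[mu]_(w in D) (h w)%:E = \int[mu]_w (h w * \1_D w)%:E)%E.
  rewrite integral_mkcond; apply: eq_integral => w _.
  by rewrite patchE indicE; case: (w \in D); rewrite ?mulr1 ?mulr0.
have mD (h : R -> R) : measurable_fun setT h ->
    measurable_fun setT (fun w => (h w * \1_D w)%:E).
  by move=> mh; apply/measurable_EFinP; apply: measurable_funM.
transitivity (\int[mu]_v \int[mu]_w f (v, w))%E.
  apply: eq_integral => v _.
  rewrite EFinM -integral_gumbelB// onD -ge0_integralZl_EFin ?expR_ge0//.
  - by apply: eq_integral => w _; rewrite /f /= -mulrA EFinM.
  - by move=> w _; rewrite lee_fin mulr_ge0// indicE.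
  - by apply: mD; apply: (measurableT_comp mk); exact: measurable_funD.
transitivity (\int[mu]_w \int[mu]_v f (v, w))%E; first exact: fubini_tonelli.
transitivity (\int[mu]_w (kernel_mass al * (expR (al * w) * \1_D w)%:E))%E.
  apply: eq_integral => w _; rewrite muleC /kernel_mass.
  (* For fixed [w], [expR (- al * v) = expR (al * w) * expR (- al * (v + w))], and the shift by [w]
     leaves the kernel mass. *)
  rewrite -(@integralT_shift (fun v => expR (- al * v) * k v) w); first last.
  - by move=> x; rewrite mulr_ge0 ?expR_ge0.
  - move=> x; apply: cvgM; last exact: ck.
    apply: continuous_comp; last exact: continuous_expR.
    by apply: cvgM; [exact: cvg_cst|exact: cvg_id].
  rewrite -ge0_integralZl_EFin//.
  - apply: eq_integral => v _; rewrite /f /= -EFinM; congr EFin.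
    rewrite (_ : - al * v = al * w + - al * (v + w)); last by ring.
    by rewrite expRD; ring.
  - by move=> v _; rewrite lee_fin mulr_ge0 ?expR_ge0.
  - apply/measurable_EFinP; apply: measurable_funM.
      by apply: (measurableT_comp (measurable_expRM _)); exact: measurable_funD.
    by apply: (measurableT_comp mk); exact: measurable_funD.
rewrite ge0_integralZl ?kernel_mass_ge0//.
- by rewrite -onD integral_expR_box.
- by apply: mD; exact: measurable_expRM.
Qed.

End Kernel.

(** * Integrability at both ends of the line *)

Section Domination.
Context {R : realType}.
Notation mu := (@lebesgue_measure R).

(** By symmetry twice a half-line integral, itself at most [e^-1] times the mass of an exponential
    density. *)
Lemma integral_expR_norm_lty (e : R) : 0 < e ->
  (\int[mu]_v (expR (- e * `|v|))%:E < +oo)%E.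
Proof.
move=> e0; have e0' := ltW e0.
have cE : continuous (fun v : R => expR (- e * `|v|)).
  move=> v; apply: continuous_comp; last exact: continuous_expR.
  by apply: cvgM; [exact: cvg_cst|exact: norm_continuous].
rewrite ge0_symfun_integralT//; last by move=> v; rewrite /= normrN.
have mpdf : measurable_fun setT (fun x => (e^-1 * exponential_pdf e x)%:E).
  by apply/measurable_EFinP; apply: measurable_funM => //; exact: measurable_exponential_pdf.
have pdf0 x : (0 <= (e^-1 * exponential_pdf e x)%:E)%E.
  by rewrite lee_fin mulr_ge0 ?invr_ge0// exponential_pdf_ge0.
apply: (@le_lt_trans _ _ (2%:E * (e^-1)%:E)%E); last by rewrite -EFinM ltry.
apply: lee_pmul => //; first by apply: integral_ge0 => v _; rewrite lee_fin expR_ge0.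
apply: (@le_trans _ _ (\int[mu]_x (e^-1 * exponential_pdf e x)%:E)%E); last first.
  under eq_integral do rewrite EFinM.
  rewrite ge0_integralZl_EFin ?invr_ge0//.
  - by rewrite integral_exponential_pdf// mule1.
  - by move=> x _; rewrite lee_fin exponential_pdf_ge0.
  - by apply/measurable_EFinP; exact: measurable_exponential_pdf.
rewrite (_ : (\int[mu]_(x in [set x : R | (0 <= x)%R]) (expR (- e * `|x|))%:E =
    \int[mu]_(x in [set x : R | (0 <= x)%R]) (e^-1 * exponential_pdf e x)%:E)%E).
  apply: ge0_subset_integral => //.
  by rewrite -set_itvcy; exact: measurable_itv.
apply: eq_integral => x; rewrite inE/= => x0.
by rewrite exponential_pdfE// ger0_norm// mulrA mulVf ?gt_eqF// mul1r.
Qed.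

Lemma gumbel_ge0 (v : R) : 0 <= gumbel v. Proof. exact: expR_ge0. Qed.

Lemma gumbel_gt0 (v : R) : 0 < gumbel v. Proof. exact: expR_gt0. Qed.

Lemma gumbel_lt1 (v : R) : gumbel v < 1.
Proof. by rewrite /gumbel expR_lt1 oppr_lt0 expR_gt0. Qed.

Lemma gumbel_ge (v : R) : 1 - expR v <= gumbel v.
Proof. by rewrite /gumbel expR_ge1Dx. Qed.

(** From [e ^ x >= x ^ (n + 1) / (n + 1)!] at [x = expR v]; it beats any exponential rate at
    [+oo]. *)
Lemma gumbel_le (n : nat) (v : R) : gumbel v <= n.+1`!%:R * expR (- (n.+1%:R * v)).
Proof.
have f0 : 0 < n.+1`!%:R :> R by rewrite ltr0n fact_gt0.
rewrite /gumbel !expRN expRM_natl ler_pdivlMr ?exprn_gt0 ?expR_gt0//.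
rewrite mulrC ler_pdivrMr ?expR_gt0// -ler_pdivrMl// mulrC.
by apply: le_trans (expR_ge1Dxn n (expR_ge0 v)); rewrite lerDr.
Qed.

(** Near [+oo] the decay of [gumbel] absorbs the factor [expR (- al * v)]; near [-oo] the factor
    [expR (v / 2)] does, as [al < 1 / 2]. The result is a bound by a multiple of
    [expR (- e * |v|)]. *)
Lemma domination (al C : R) (f : R -> R) : al < 1 / 2 -> 0 <= C ->
  measurable_fun setT f -> (forall v, 0 <= f v <= gumbel v) ->
  (forall v, v <= 0 -> f v <= C * expR (v / 2)) ->
  (\int[mu]_v (expR (- al * v) * f v)%:E < +oo)%E.
Proof.
move=> al2 C0 mf fg fC.
have [n n_ge] : exists n : nat, 1 - al <= n.+1%:R.
  exists (Num.truncn `|1 - al|).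
  by apply: (le_trans (ler_norm _)); apply/ltW; rewrite truncnS_gt.
pose M : R := n.+1`!%:R + C.
have M0 : 0 <= M by rewrite addr_ge0.
(* [e <= 1 / 2 - al] serves the left half-line, [e <= 1 <= n + 1 + al] the right one. *)
pose e := Num.min (1 / 2 - al) 1.
have e0 : 0 < e by rewrite /e lt_min; lra.
have e1 : e <= 1 by rewrite /e ge_min lexx orbT.
have e2 : e <= 1 / 2 - al by rewrite /e ge_min lexx.
have m1 : measurable_fun setT (fun v : R => expR (- e * `|v|)).
  apply: continuous_measurable_fun.
  move=> v; apply: continuous_comp; last exact: continuous_expR.
  by apply: cvgM; [exact: cvg_cst|exact: norm_continuous].
apply: (@le_lt_trans _ _ (\int[mu]_v (M * expR (- e * `|v|))%:E)%E); last first.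
  under eq_integral do rewrite EFinM.
  rewrite ge0_integralZl_EFin//.
  - by rewrite lte_mul_pinfty// integral_expR_norm_lty.
  - exact/measurable_EFinP.
apply: ge0_le_integral => //.
- by move=> v _; rewrite lee_fin mulr_ge0 ?expR_ge0//; case/andP: (fg v).
- by apply/measurable_EFinP; apply: measurable_funM => //; exact: measurable_expRM.
- by apply/measurable_EFinP; apply: measurable_funM.
move=> v _; rewrite lee_fin; have /andP[f0 fv] := fg v.
have fn0 : 0 <= n.+1`!%:R :> R by rewrite ler0n.
have [v0|v0] := leP 0 v.
  rewrite ger0_norm//; apply: (@le_trans _ _ (n.+1`!%:R * expR (- e * v))); last first.
    by rewrite ler_wpM2r ?expR_ge0// lerDl.
  apply: (@le_trans _ _ (expR (- al * v) * (n.+1`!%:R * expR (- (n.+1%:R * v))))).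
    by rewrite ler_wpM2l ?expR_ge0// (le_trans fv) ?gumbel_le.
  rewrite mulrCA ler_wpM2l// -expRD ler_expR; nra.
rewrite ltr0_norm//; apply: (@le_trans _ _ (C * expR (- e * - v))); last first.
  by rewrite ler_wpM2r ?expR_ge0// lerDr.
apply: (@le_trans _ _ (expR (- al * v) * (C * expR (v / 2)))).
  by rewrite ler_wpM2l ?expR_ge0// fC// ltW.
rewrite mulrCA ler_wpM2l// -expRD ler_expR; nra.
Qed.

End Domination.

(** * Moments of the total size *)

Section BoxMoment.
Context {R : realType}.
Notation mu := (@lebesgue_measure R).

Lemma gumbel_shift (v : R) n : (0 < n)%N -> gumbel (v + ln n%:R) = gumbel v ^+ n.
Proof.
move=> n0; rewrite /gumbel expRD lnK ?posrE ?ltr0n//.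
by rewrite -expRM_natl mulrN mulrC.
Qed.

Lemma box_ge0 (al a : R) : 0 <= a -> 0 <= box al a.
Proof.
move=> a0; rewrite -lee_fin -integral_expR_box//; apply: integral_ge0 => v _.
by rewrite lee_fin expR_ge0.
Qed.

Lemma box_gt0 (al a : R) : 0 < a -> 0 < box al a.
Proof.
move=> a0; rewrite /box; have [al0|al0|//] := ltgtP al 0.
  rewrite -mulrNN mulr_gt0//; last by rewrite oppr_gt0 invr_lt0.
  by rewrite oppr_gt0 subr_lt0 expR_lt1 nmulr_rlt0.
by rewrite divr_gt0// subr_gt0 expR_gt1 mulr_gt0.
Qed.

(** Read backwards at [a = ln 2], [integral_kernel] has the integrand [expR (- al * v) * (gumbel v -
    gumbel v ^ 2)], which [domination] controls; an infinite mass would make that integral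
    infinite. *)
Lemma kernel_mass_fin (al : R) : al < 1 / 2 -> kernel_mass al \is a fin_num.
Proof.
move=> al2; rewrite ge0_fin_numE ?kernel_mass_ge0//.
have l2 : 0 < ln 2 :> R by rewrite ln_gt0// ltr1n.
have mg : measurable_fun setT (@gumbel R).
  by apply: continuous_measurable_fun; exact: continuous_gumbel.
have : (kernel_mass al * (box al (ln 2))%:E < +oo)%E.
  rewrite -integral_kernel ?(ltW l2)//.
  under eq_integral do rewrite gumbel_shift//.
  apply: (@domination _ al 1) => //.
  - by apply: measurable_funB => //; exact: measurable_funX.
  - move=> v; have g0 := gumbel_ge0 v; have g1 := gumbel_lt1 v; rewrite expr2; nra.
  - move=> v v0; have g0 := gumbel_ge0 v; have g1 := gumbel_lt1 v.
    have := gumbel_ge v; have : expR v <= expR (v / 2) by rewrite ler_expR; lra.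
    rewrite expr2; nra.
rewrite !ltey; apply: contra => /eqP ->.
by rewrite gt0_mulye// lte_fin box_gt0.
Qed.

(** [E (|T| ^ al - 1) / al], or [E ln |T|] when [al = 0]. *)
Definition gw_boxmoment (p : nat -> R) (al : R) : \bar R :=
  (\esum_(t in [set: ptree]) (gw_weight p t * box al (ln (psize t)%:R))%:E)%E.

Section OneLaw.
Variable p : nat -> R.
Hypothesis crit : critical_offspring p.

Let w0 t : 0 <= gw_weight p t.
Proof. by apply: gw_weight_ge0; case: crit. Qed.

Lemma gw_total : (\esum_(t in [set: ptree]) (gw_weight p t)%:E = 1)%E.
Proof.
rewrite -(tree_gf1 crit) -tree_gfE ?lexx ?ler01//.
by apply: eq_esum => t _; rewrite expr1n mulr1.
Qed.

Lemma esum_tree_gfB (z : R) : 0 <= z <= 1 ->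
  (\esum_(t in [set: ptree]) (gw_weight p t * (z - z ^+ psize t))%:E =
   (z - tree_gf p z)%:E)%E.
Proof.
move=> z01; have /andP[z0 z1] := z01.
rewrite EFinB -tree_gfE//.
set S := (LHS); set Y := (X in (_ - X)%E).
have Yf : Y \is a fin_num by rewrite /Y tree_gfE.
(* With the subtracted sum moved to the other side, all terms are nonnegative and sums are
   additive. *)
suff -> : z%:E = (S + Y)%E by rewrite addeK.
rewrite -[z%:E]mule1 -gw_total -esumZl//.
rewrite -esumD; first by apply: eq_esum => t _; rewrite -EFinM -EFinD; congr EFin; ring.
- move=> t _; rewrite lee_fin mulr_ge0// subr_ge0.
  by rewrite -[leRHS]expr1 ler_wiXn2l// psize_gt0.
- by move=> t _; rewrite lee_fin mulr_ge0// exprn_ge0.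
Qed.

Lemma gw_boxmoment_integral (al : R) : al < 1 / 2 ->
  (kernel_mass al * gw_boxmoment p al =
   \int[mu]_v (expR (- al * v) * (gumbel v - tree_gf p (gumbel v)))%:E)%E.
Proof.
move=> al2; have Kf := kernel_mass_fin al2.
pose h v t : R := gw_weight p t * (expR (- al * v) * (gumbel v - gumbel v ^+ psize t)).
have d0 v t : 0 <= gumbel v - gumbel v ^+ psize t :> R.
  rewrite subr_ge0 -[leRHS]expr1.
  by rewrite ler_wiXn2l ?gumbel_ge0 ?(ltW (gumbel_lt1 v)) ?psize_gt0.
have h0 v t : 0 <= h v t by rewrite !mulr_ge0 ?expR_ge0.
have mg : measurable_fun setT (@gumbel R).
  by apply: continuous_measurable_fun; exact: continuous_gumbel.
have mh t : measurable_fun setT (fun v => expR (- al * v) * (gumbel v - gumbel v ^+ psize t)).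
  apply: measurable_funM; first exact: measurable_expRM.
  by apply: measurable_funB => //; exact: measurable_funX.
(* The expectation becomes a series over codes of trees, whose nonnegative terms may be integrated
   one by one. *)
transitivity (\int[mu]_v \sum_(0 <= n <oo) oapp (fun t => (h v t)%:E) 0 (pickle_inv n))%E; last first.
  apply: eq_integral => v _; rewrite -esum_pickle; last by move=> t; rewrite lee_fin.
  rewrite EFinM -esum_tree_gfB ?gumbel_ge0 ?(ltW (gumbel_lt1 v))//.
  rewrite -esumZl ?expR_ge0//; last by move=> t; rewrite lee_fin mulr_ge0.
  by apply: eq_esum => t _; rewrite -EFinM /h mulrCA.
rewrite integral_nneseries//; last 2 first.
- move=> n; case: (pickle_inv n) => [t|] /=; last exact: measurable_cst.
  apply/measurable_EFinP; apply: measurable_funM => //; exact: mh.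
- by move=> n v _; case: (pickle_inv n) => [t|] //=; rewrite lee_fin.
rewrite -(fineK Kf) -esumZl; last 2 first.
- by rewrite fine_ge0// kernel_mass_ge0.
- by move=> t; rewrite lee_fin mulr_ge0// box_ge0// ln_ge0// ler1n psize_gt0.
rewrite esum_pickle; last first.
  move=> t; rewrite fineK// mule_ge0 ?kernel_mass_ge0// lee_fin mulr_ge0//.
  by rewrite box_ge0// ln_ge0// ler1n psize_gt0.
apply: eq_eseriesr => n _; case: (pickle_inv n) => [t|] /=; last first.
  by rewrite integral0.
under [RHS]eq_integral do rewrite /h EFinM.
rewrite ge0_integralZl_EFin//; last 2 first.
- by move=> v _; rewrite lee_fin mulr_ge0 ?expR_ge0.
- by apply/measurable_EFinP; exact: mh.
(* Each tree contributes the kernel identity at [a = ln (psize t)]. *)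
under [in RHS]eq_integral do rewrite -gumbel_shift ?psize_gt0//.
rewrite integral_kernel ?fineK// ?EFinM 1?muleCA//.
by rewrite ln_ge0// ler1n psize_gt0.
Qed.

Lemma measurable_tree_gf_gumbel : measurable_fun setT (fun v : R => tree_gf p (gumbel v)).
Proof.
apply: nonincreasing_measurable => // v v' vv'.
apply: (tree_gf_homo crit); rewrite ?gumbel_ge0 ?(ltW (gumbel_lt1 _))//.
by rewrite /gumbel ler_expR lerN2 ler_expR.
Qed.

Lemma integral_tree_gf_gumbel_lty (al : R) : al < 1 / 2 ->
  (\int[mu]_v (expR (- al * v) * (gumbel v - tree_gf p (gumbel v)))%:E < +oo)%E.
Proof.
move=> al2; have [c c0 quad] := tree_gf_quad crit.
have gi (v : R) : 0 <= gumbel v <= 1 by rewrite gumbel_ge0 ltW// gumbel_lt1.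
(* For [v <= 0], [gumbel v >= expR (-1)], so [tree_gf_quad] yields [(1 - y) ^ 2 <= (expR 1 / c) * (1
   - gumbel v) <= (expR 1 / c) * expR v]. *)
pose C := Num.sqrt (expR 1 / c).
have Cc : 0 <= expR 1 / c by rewrite divr_ge0// ?expR_ge0// ltW.
apply: (@domination _ al C) => //.
- exact: sqrtr_ge0.
- apply: measurable_funB; last exact: measurable_tree_gf_gumbel.
  by apply: continuous_measurable_fun; exact: continuous_gumbel.
- move=> v; have := tree_gf_ge0 crit (gi v); have := tree_gf_lez crit (gi v); lra.
move=> v v0; have := tree_gf_ge0 crit (gi v); have := tree_gf_lez crit (gi v).
have := quad _ (gi v); have := gumbel_ge v.
have gE : expR (-1) <= gumbel v.
  by rewrite /gumbel ler_expR lerN2 -[leRHS](@expR0 R) ler_expR.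
move: (tree_gf p _) (gumbel_lt1 v) => y g1 gx q y1 y0.
apply: (@le_trans _ _ (1 - y)); first lra.
rewrite -ler_sqr ?nnegrE; [|lra|by rewrite mulr_ge0 ?sqrtr_ge0 ?expR_ge0].
rewrite exprMn sqr_sqrtr// -expRM_natl [2 * _]mulrC divfK// mulrAC ler_pdivlMr//.
rewrite -ler_pdivrMl ?expR_gt0// -expRN.
have := sqr_ge0 (1 - y); set Q := _ ^+ 2 in q * => Q0.
apply: le_trans (_ : gumbel v * c * Q <= _); last lra.
by rewrite mulrA mulrAC ler_wpM2r// ler_wpM2r// ltW.
Qed.

End OneLaw.
End BoxMoment.

(** * Comparison of the two laws *)

Section Comparison.
Context {R : realType}.
Notation mu := (@lebesgue_measure R).

(** The two integrals differ by that of [d], which is nonnegative and bounded below by a positive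
    constant on an interval. *)
Lemma lt_gw_boxmoment (p1 p2 : nat -> R) (al : R) :
  critical_offspring p1 -> critical_offspring p2 -> pgf_lt p1 p2 ->
  al < 1 / 2 -> (gw_boxmoment p2 al < gw_boxmoment p1 al)%E.
Proof.
move=> c1 c2 lt12 al2.
have gi (v : R) : 0 < gumbel v < 1 by rewrite gumbel_gt0 gumbel_lt1.
have gi' (v : R) : 0 <= gumbel v <= 1 by have := gi v; lra.
pose d (v : R) := expR (- al * v) * (tree_gf p2 (gumbel v) - tree_gf p1 (gumbel v)).
have d0 v : 0 <= d v by rewrite mulr_ge0 ?expR_ge0// subr_ge0 le_tree_gf.
have md : measurable_fun setT d.
  apply: measurable_funM; first exact: measurable_expRM.
  by apply: measurable_funB; exact: measurable_tree_gf_gumbel.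
have mg : measurable_fun setT (@gumbel R).
  by apply: continuous_measurable_fun; exact: continuous_gumbel.
have d_gt0 : (0 < \int[mu]_v (d v)%:E)%E.
  have [e [z0 [z1 [e0 z00 z01 z11 ez]]]] := lt_tree_gf c1 c2 lt12.
  have lz0 : 0 < - ln z0 by rewrite oppr_gt0 ln_lt0// z00 (lt_trans z01).
  have lz1 : 0 < - ln z1 by rewrite oppr_gt0 ln_lt0// (lt_trans z00)// z11.
  (* Preimages of [z1] and [z0] under the decreasing [gumbel], hence the reversed order. *)
  pose v1 := ln (- ln z1); pose v0 := ln (- ln z0).
  have v10 : v1 < v0.
    by rewrite ltr_ln ?posrE// ltrN2 ltr_ln ?posrE// (lt_trans z00).
  pose m := expR (- (`|al| * (`|v1| + `|v0|))) * e.
  have m0 : 0 < m by rewrite mulr_gt0// expR_gt0.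
  apply: (@lt_le_trans _ _ (\int[mu]_(v in `[v1, v0]) (cst m%:E) v)%E).
    rewrite integral_cst//= lebesgue_measure_itv/= lte_fin v10 -EFinB -EFinM lte_fin.
    by rewrite mulr_gt0// subr_gt0.
  apply: (@le_trans _ _ (\int[mu]_(v in `[v1, v0]) (d v)%:E)%E); last first.
    apply: ge0_subset_integral => //; first exact/measurable_EFinP.
    by move=> v _; rewrite lee_fin.
  apply: ge0_le_integral => //.
  - by move=> v _; rewrite lee_fin ltW.
  - by apply/measurable_EFinP; exact: measurable_funTS.
  move=> v; rewrite /= in_itv/= => /andP[v1v vv0]; rewrite lee_fin.
  apply: ler_pM; [exact: expR_ge0|exact: ltW| |].
    rewrite ler_expR mulNr lerN2; apply: le_trans (ler_norm _) _.
    rewrite normrM ler_wpM2l//; have := ler_norm v0; have := ler_norm (- v1).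
    have := normr_ge0 v1; have := normr_ge0 v0.
    by rewrite normrN ler_norml; lra.
  rewrite lerBrDl; apply: ez; rewrite /gumbel; apply/andP; split.
    rewrite -[leLHS]lnK ?posrE// ler_expR lerNr -[leRHS]lnK ?posrE//.
    by rewrite ler_expR.
  rewrite -[leRHS]lnK ?posrE ?(lt_trans z00)// ler_expR lerNl -[leLHS]lnK ?posrE//.
  by rewrite ler_expR.
have K0 := kernel_mass_ge0 al; have I2 := integral_tree_gf_gumbel_lty c2 al2.
have f20 v : 0 <= expR (- al * v) * (gumbel v - tree_gf p2 (gumbel v)).
  by rewrite mulr_ge0 ?expR_ge0// subr_ge0 tree_gf_lez.
(* Multiplication by the nonnegative mass preserves [<=], so strictness of the products passes to
   the factors. *)
suff : (kernel_mass al * gw_boxmoment p2 al < kernel_mass al * gw_boxmoment p1 al)%E.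
  by apply: contraTT; rewrite -!leNgt => h; exact: lee_wpmul2l.
rewrite !gw_boxmoment_integral//.
rewrite [ltRHS](_ : _ = (\int[mu]_v (expR (- al * v) * (gumbel v - tree_gf p2 (gumbel v)))%:E
   + \int[mu]_v (d v)%:E)%E); last first.
  rewrite -ge0_integralD//.
  - by apply: eq_integral => v _; rewrite -EFinD; congr EFin; rewrite /d; ring.
  - by move=> v _; rewrite lee_fin.
  - apply/measurable_EFinP; apply: measurable_funM; first exact: measurable_expRM.
    by apply: measurable_funB => //; exact: measurable_tree_gf_gumbel.
  - by move=> v _; rewrite lee_fin.
  - exact/measurable_EFinP.
(* Adding a positive amount is strict because the integral for [p2] is finite. *)
rewrite lteDl// ge0_fin_numE//.
by apply: integral_ge0 => v _; rewrite lee_fin.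
Qed.

Lemma powR_box (al : R) n : al != 0 -> (0 < n)%N ->
  n%:R `^ al = 1 + al * box al (ln n%:R).
Proof.
move=> al0 n0; rewrite /powR pnatr_eq0 (gtn_eqF n0) /box (negbTE al0).
by rewrite mulrCA mulfV// mulr1 addrC subrK.
Qed.

(** * Power and logarithmic moments *)

Section Moments.
Variables (p : nat -> R) (crit : critical_offspring p).

Let w0 t : 0 <= gw_weight p t.
Proof. by apply: gw_weight_ge0; case: crit. Qed.

Let b0 al t : 0 <= gw_weight p t * box al (ln (psize t)%:R).
Proof. by rewrite mulr_ge0// box_ge0// ln_ge0// ler1n psize_gt0. Qed.

Lemma gw_moment_pos (al : R) : 0 < al ->
  gw_moment p al = (1 + al%:E * gw_boxmoment p al)%E.
Proof.
move=> al0; rewrite -(gw_total crit) -esumZl ?ltW//; last by move=> t; rewrite lee_fin.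
rewrite -esumD; first last.
- by move=> t _; rewrite -EFinM lee_fin mulr_ge0// ltW.
- by move=> t _; rewrite lee_fin.
apply: eq_esum => t _; rewrite powR_box ?gt_eqF ?psize_gt0//.
by rewrite -EFinM -EFinD; congr EFin; ring.
Qed.

(** Here [al * box] is nonpositive; moved to the left with coefficient [- al] it keeps all sums
    nonnegative. *)
Lemma gw_moment_neg (al : R) : al < 0 ->
  (gw_moment p al + (- al)%:E * gw_boxmoment p al = 1)%E.
Proof.
move=> al0; have al0' : 0 <= - al by lra.
rewrite -(gw_total crit) -esumZl//; last by move=> t; rewrite lee_fin.
rewrite -esumD; first last.
- by move=> t _; rewrite -EFinM lee_fin mulr_ge0.
- by move=> t _; rewrite lee_fin mulr_ge0// powR_ge0.
apply: eq_esum => t _; rewrite powR_box ?lt_eqF ?psize_gt0//.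
by rewrite -EFinM -EFinD; congr EFin; ring.
Qed.

Lemma gw_moment_ge0 (al : R) : (0 <= gw_moment p al)%E.
Proof. by apply: esum_ge0 => t _; rewrite lee_fin mulr_ge0// powR_ge0. Qed.

Lemma gw_logmomentE : gw_logmoment p = gw_boxmoment p 0.
Proof. by apply: eq_esum => t _; rewrite /box eqxx. Qed.

Lemma gw_boxmoment_ge0 (al : R) : (0 <= gw_boxmoment p al)%E.
Proof. by apply: esum_ge0 => t _; rewrite lee_fin. Qed.

End Moments.
End Comparison.

Theorem theorem6p8 (R : realType) (p1 p2 : nat -> R) :
  critical_offspring p1 -> critical_offspring p2 -> pgf_lt p1 p2 ->
  [/\ (forall alpha : R, alpha < 0 -> (gw_moment p1 alpha < gw_moment p2 alpha)%E),
      (forall alpha : R, 0 < alpha < 1 / 2 -> (gw_moment p2 alpha < gw_moment p1 alpha)%E) &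
      (gw_logmoment p2 < gw_logmoment p1)%E].
Proof.
move=> c1 c2 lt12; have lt_box al := lt_gw_boxmoment (al := al) c1 c2 lt12.
split => [al al0|al /andP[al0 al2]|].
- have /lt_box : al < 1 / 2 by lra.
  have := gw_moment_neg c1 al0; have := gw_moment_neg c2 al0.
  have := gw_moment_ge0 c1 al; have := gw_moment_ge0 c2 al.
  have := gw_boxmoment_ge0 c1 al; have := gw_boxmoment_ge0 c2 al.
  have al0' : 0 < - al by lra.
  (* Nonnegative terms with sum 1 are finite, so the claim reduces to real numbers. *)
  move: (gw_moment p1 al) (gw_moment p2 al) => [m1| |] [m2| |] //;
  move: (gw_boxmoment p1 al) (gw_boxmoment p2 al) => [b1| |] [b2| |] //;
    rewrite ?gt0_muley ?lte_fin// -!EFinM -!EFinD ?lee_fin ?lte_fin.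
  move=> _ _ _ _ [h2] [h1] b12; nra.
- rewrite !gw_moment_pos// lteD2lE// lte_pmul2l// ?lte_fin//; exact: lt_box.
- by rewrite !gw_logmomentE; apply: lt_box; lra.
Qed.
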